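(* Let $x\in\mathcal S\cdot\mathcal Y$ and let $\mathbf X\in\mathbb R^{q\times s}$ be its associated matrix of coefficients. Let $1\le \hat q\le q$. Then a best-approximating $\hat q$-dimensional subspace $\hat{\mathcal Y}\subset\mathcal Y$, in the sense that $\|x-\Pi_{\mathcal S\cdot\hat{\mathcal Y}}x\|_{\mathcal S\cdot\mathcal Y}$ is minimal over all subspaces of $\mathcal Y$ of dimension $\hat q$, is given by $\hat{\mathcal Y}=\operatorname{span}\{\hat\nu_i\}_{i=1,\dots,\hat q}$, where $$\begin{bmatrix}\hat\nu_1\\ \hat\nu_2\\ \vdots\\ \hat\nu_{\hat q}\end{bmatrix}=V_{\hat q}^{\mathsf T}\,\mathbf L_{\mathcal Y}^{-1}\begin{bmatrix}\nu_1\\ \nu_2\\ \vdots\\ \nu_q\end{bmatrix}$$ and $V_{\hat q}\in\mathbb R^{q\times\hat q}$ is the matrix of the $\hat q$ leading left singular vectors of the matrix $\mathbf L_{\mathcal Y}^{\mathsf T}\mathbf X\mathbf L_{\mathcal S}$.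
   Context: Let $T>0$, let $(0,T)$ be a time interval and $\Omega$ a spatial domain; all functions are real-valued. Let $\mathcal S=\operatorname{span}\{\psi_1,\dots,\psi_s\}\subset L^2(0,T)$ and $\mathcal Y=\operatorname{span}\{\nu_1,\dots,\nu_q\}\subset L^2(\Omega)$ be subspaces of dimension $s$ and $q$, respectively (so the $\psi_j$ and the $\nu_i$ are bases). For subspaces $\mathcal S'\subset L^2(0,T)$ and $\mathcal Y'\subset L^2(\Omega)$, $\mathcal S'\cdot\mathcal Y'\subset L^2(0,T;L^2(\Omega))$ denotes the linear span of the products $\nu\psi$, $(\nu\psi)(\xi,\tau)=\nu(\xi)\psi(\tau)$, with $\nu\in\mathcal Y'$, $\psi\in\mathcal S'$. Every $x\in\mathcal S\cdot\mathcal Y$ is written uniquely as $x=\sum_{j=1}^s\sum_{i=1}^q\mathbf x_{i\cdot j}\,\nu_i\psi_j$, and its associated matrix of coefficients is $\mathbf X=[\mathbf x_{i\cdot j}]_{i=1,\dots,q}^{j=1,\dots,s}\in\mathbb R^{q\times s}$ ($i$ is the row index, $j$ the column index). The norm is $\|x\|_{\mathcal S\cdot\mathcal Y}^2=\int_0^T\int_\Omega x(\xi,\tau)^2\,\mathrm d\xi\,\mathrm d\tau$, and $\Pi_{\mathcal S\cdot\hat{\mathcal Y}}$ denotes the orthogonal projection onto $\mathcal S\cdot\hat{\mathcal Y}$ with respect to the corresponding space-time $L^2$ inner product. The mass matrices are $\mathbf M_{\mathcal Y}=[(\nu_i,\nu_j)_{L^2(\Omega)}]_{i,j=1}^q$ and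 $\mathbf M_{\mathcal S}=[(\psi_i,\psi_j)_{L^2(0,T)}]_{i,j=1}^s$, and they are given in factored form $\mathbf M_{\mathcal Y}=\mathbf L_{\mathcal Y}\mathbf L_{\mathcal Y}^{\mathsf T}$, $\mathbf M_{\mathcal S}=\mathbf L_{\mathcal S}\mathbf L_{\mathcal S}^{\mathsf T}$ with square (hence invertible) real matrices $\mathbf L_{\mathcal Y}$, $\mathbf L_{\mathcal S}$ (e.g. Cholesky factors). ''The $\hat q$ leading left singular vectors'' means the (orthonormal) left singular vectors belonging to the $\hat q$ largest singular values, counted with multiplicity and with zero singular values included if necessary, in a singular value decomposition with a full orthonormal set of $q$ left singular vectors. *)

(* Defs.v *)
From HB Require Import structures.
From mathcomp Require Import all_boot all_order all_algebra.
From mathcomp Require Import all_classical all_reals all_analysis.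

Set Implicit Arguments.
Unset Strict Implicit.
Unset Printing Implicit Defensive.

Import Order.TTheory GRing.Theory Num.Theory.
Import numFieldNormedType.Exports.

Local Open Scope classical_set_scope.
Local Open Scope ring_scope.

(* Restriction of a sigma-finite measure to a measurable set; the product of
   measures needs the sigma-finiteness to be found by unification. *)
Section sigma_finite_restriction.
Context d (X : measurableType d) (R : realType).
Variables (mu : {sigma_finite_measure set X -> \bar R}) (D : set X).
Hypothesis mD : measurable D.

Definition restr_measure : set X -> \bar R := mrestr mu mD.

HB.instance Definition _ := Measure.on restr_measure.

Let restr_measure_sigma_finite : sigma_finite setT restr_measure.
Proof.
have [F TF mF] := sigma_finiteT mu.
exists F => // i; have [mFi Fi_fin] := mF i; split => //.
rewrite /restr_measure /mrestr (le_lt_trans _ Fi_fin)//.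
by apply: le_measure; rewrite ?inE//; exact: measurableI.
Qed.

HB.instance Definition _ :=
  Measure_isSigmaFinite.Build _ _ _ restr_measure restr_measure_sigma_finite.

End sigma_finite_restriction.

(* The library declares the sigma-finiteness of a product measure behind an
   instance for probabilities with the same key, so it is not inferred. *)
Lemma product_measure_sigma_finite d1 d2 (X1 : measurableType d1)
    (X2 : measurableType d2) (R : realType)
    (m1 : {sigma_finite_measure set X1 -> \bar R})
    (m2 : {sigma_finite_measure set X2 -> \bar R}) :
  sigma_finite setT (m1 \x m2)%E.
Proof.
have /sigma_finiteP[F [TF ndF Foo]] := sigma_finiteT m1.
have /sigma_finiteP[G [TG ndG Goo]] := sigma_finiteT m2.
exists (fun n => F n `*` G n).
  rewrite -setXTT TF TG predeqE => -[x y]; split.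
    move=> [/= [n _ Fnx] [k _ Gky]]; exists (maxn n k) => //; split.
    - by move: x Fnx; exact/subsetPset/ndF/leq_maxl.
    - by move: y Gky; exact/subsetPset/ndG/leq_maxr.
  by move=> [n _ []/= ? ?]; split; exists n.
move=> k; have [? ?] := Foo k; have [? ?] := Goo k.
split; first exact: measurableX.
by rewrite product_measure1E// lte_mul_pinfty// ge0_fin_numE.
Qed.

(* n-fold product of a measure, carried by n.-tuple X; for the Lebesgue measure
   on R, [power_measure_box] characterizes it as the Lebesgue measure on R^n. *)
Section power_measure.
Context d (X : measurableType d) (R : realType).
Variable mu : {sigma_finite_measure set X -> \bar R}.

Definition cons_pair n (z : X * n.-tuple X) : n.+1.-tuple X :=
  [the n.+1.-tuple X of z.1 :: z.2].

Lemma measurable_cons_pair n : measurable_fun setT (@cons_pair n).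
Proof. exact: measurable_cons. Qed.

Section power_step.
Variables (n : nat) (m : {sigma_finite_measure set (n.-tuple X) -> \bar R}).

Definition power_step : set (n.+1.-tuple X) -> \bar R :=
  pushforward (mu \x m)%E (@cons_pair n).

Let power_step0 : power_step set0 = 0%E.
Proof. by rewrite /power_step /pushforward preimage_set0 measure0. Qed.

Let power_step_ge0 A : (0 <= power_step A)%E.
Proof. exact: (measure_ge0 (mu \x m)%E). Qed.

Let power_step_sigma_additive : semi_sigma_additive power_step.
Proof.
move=> F mF tF mUF; rewrite /power_step /pushforward preimage_bigcup.
apply: measure_semi_sigma_additive.
- move=> i; rewrite -[X in measurable X]setTI.
  exact: (measurable_cons_pair measurableT).
- apply/trivIsetP => /= i j _ _ ij; rewrite -preimage_setI.
  by move/trivIsetP : tF => /(_ _ _ _ _ ij) ->//; rewrite preimage_set0.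
- rewrite -preimage_bigcup -[X in measurable X]setTI.
  exact: (measurable_cons_pair measurableT).
Qed.

HB.instance Definition _ := isMeasure.Build _ _ _ power_step
  power_step0 power_step_ge0 power_step_sigma_additive.

Let power_step_sigma_finite : sigma_finite setT power_step.
Proof.
have [F TF mF] := product_measure_sigma_finite mu m.
pose g (t : n.+1.-tuple X) : X * n.-tuple X :=
  (tnth t ord0, [tuple of behead t]).
have mg : measurable_fun setT g.
  apply/measurable_fun_pairP; split; first exact: measurable_tnth.
  exact: measurable_behead.
have cg z : g (cons_pair z) = z.
  by case: z => a t; rewrite /g; congr pair; exact/val_inj.
exists (fun i => g @^-1` F i).
  by rewrite -preimage_bigcup -TF preimage_setT.
move=> i; have [mFi Fi_fin] := mF i; split.
  by rewrite -[X in measurable X]setTI; exact: mg.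
rewrite /power_step /pushforward.
by rewrite (_ : _ @^-1` _ = F i)//; apply/funext => z /=; rewrite /preimage/= cg.
Qed.

HB.instance Definition _ :=
  Measure_isSigmaFinite.Build _ _ _ power_step power_step_sigma_finite.

End power_step.

Fixpoint power_measure n : {sigma_finite_measure set (n.-tuple X) -> \bar R} :=
  match n with
  | 0 => \d_([tuple] : 0.-tuple X)
  | n'.+1 => power_step (power_measure n')
  end.

Lemma power_measure_box n (A : 'I_n -> set X) : (forall i, measurable (A i)) ->
  power_measure n [set t | forall i, A i (tnth t i)] =
  (\prod_(i < n) mu (A i))%E.
Proof.
elim: n A => [|n IH] A mA /=.
  rewrite big_ord0 diracE mem_set// => i; by case: i.
rewrite /power_step /pushforward big_ord_recl -IH//.
rewrite -product_measure1E//; last first.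
  rewrite (_ : [set _ | _] =
      \bigcap_(i in [set: 'I_n]) (fun t => tnth t i) @^-1` A (lift ord0 i)).
    apply: fin_bigcap_measurable => // i _; rewrite -[X in measurable X]setTI.
    exact: measurable_tnth.
  by apply/seteqP; split => t /= h i => [_|]; exact: h.
congr (_ _); apply/seteqP; split => -[a t] /=.
- move=> h; split=> [|i]; first exact: (h ord0).
  by have := h (lift ord0 i); rewrite tnthS.
- move=> [Aa h] i; case: (unliftP ord0 i) => [j ->|->//].
  by rewrite tnthS; exact: h.
Qed.

End power_measure.

Section spacetime_measures.
Variable R : realType.

Definition time_measure (T : R) :
    {sigma_finite_measure set (measurableTypeR R) -> \bar R} :=
  restr_measure (@lebesgue_measure R) (measurable_itv `]0, T[).

Definition space_measure n (Omega : set (n.-tuple (measurableTypeR R)))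
    (mOmega : measurable Omega) :
    {sigma_finite_measure set (n.-tuple (measurableTypeR R)) -> \bar R} :=
  restr_measure (power_measure (@lebesgue_measure R) n) mOmega.

End spacetime_measures.

(* Elements of L^2 are represented by functions.  A linear subspace of L^2 is the
   set of all its representatives, i.e., a set of square-integrable functions
   saturated under almost everywhere equality, so that two subspaces are equal
   if and only if they are equal as sets. *)
Section L2.
Context d (X : measurableType d) (R : realType).
Variable mu : {measure set X -> \bar R}.

Definition L2 : set (X -> R) := [set f | f \in Lfun mu 2%:E].

Definition L2span (A : set (X -> R)) : set (X -> R) :=
  [set f | L2 f /\ exists (n : nat) (c : 'I_n -> R) (g : 'I_n -> X -> R),
     (forall i, A (g i)) /\ f = \sum_(i < n) c i *: g i %[ae mu]].

Definition L2free n (f : 'I_n -> X -> R) : Prop :=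
  forall c : 'I_n -> R, \sum_(i < n) c i *: f i = 0 %[ae mu] ->
    forall i, c i = 0.

Definition L2basis (W : set (X -> R)) n (f : 'I_n -> X -> R) : Prop :=
  [/\ forall i, L2 (f i), L2free f & W = L2span (range f)].

Definition L2subspace_dim (W : set (X -> R)) (n : nat) : Prop :=
  exists f : 'I_n -> X -> R, L2basis W f.

Definition L2inner (f g : X -> R) : R := \int[mu]_x (f x * g x).

Definition mass_matrix n (f : 'I_n -> X -> R) : 'M[R]_n :=
  \matrix_(i, j) L2inner (f i) (f j).

End L2.

Section spacetime.
Context d (X : measurableType d) d' (Z : measurableType d') (R : realType).
Variable mu : {sigma_finite_measure set X -> \bar R}. (* space *)
Variable tau : {sigma_finite_measure set Z -> \bar R}. (* time *)

Definition st_mul (nu : X -> R) (psi : Z -> R) : X * Z -> R :=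
  fun z => nu z.1 * psi z.2.

(* S . Y, inside L^2 of the product measure, identified with
   L^2(0, T; L^2(Omega)). *)
Definition st_space (S : set (Z -> R)) (Y : set (X -> R)) : set (X * Z -> R) :=
  L2span (mu \x tau)%E
    [set z | exists nu psi, [/\ Y nu, S psi & z = st_mul nu psi]].

Definition st_coefficients q s (nu : 'I_q -> X -> R) (psi : 'I_s -> Z -> R)
    (x : X * Z -> R) (M : 'M[R]_(q, s)) : Prop :=
  x = \sum_(j < s) \sum_(i < q) M i j *: st_mul (nu i) (psi j)
    %[ae (mu \x tau)%E].

Definition st_inner (x y : X * Z -> R) : R :=
  \int[tau]_t \int[mu]_xi (x (xi, t) * y (xi, t)).

Definition st_norm (x : X * Z -> R) : R := Num.sqrt (st_inner x x).

Definition is_st_proj (V : set (X * Z -> R)) (x p : X * Z -> R) : Prop :=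
  V p /\ forall v, V v -> st_inner (x - p) v = 0.

(* A representative of the orthogonal projection of x onto V, which exists for
   the finite-dimensional V used here and is unique almost everywhere. *)
Definition st_proj (V : set (X * Z -> R)) (x : X * Z -> R) : X * Z -> R :=
  xget 0 [set p | is_st_proj V x p].

End spacetime.

(* Full singular value decomposition A = U D W^T, with the singular values on
   the diagonal of D in nonincreasing order. *)
Definition is_svd (R : realType) q s (A : 'M[R]_(q, s)) (U : 'M[R]_q)
    (D : 'M[R]_(q, s)) (W : 'M[R]_s) : Prop :=
  [/\ A = U *m D *m W^T,
      U^T *m U = 1%:M,
      W^T *m W = 1%:M,
      forall (i : 'I_q) (j : 'I_s), (i != j :> nat) -> D i j = 0 &
      (forall i j, 0 <= D i j) /\
      (forall (i i' : 'I_q) (j j' : 'I_s), i = j :> nat -> i' = j' :> nat ->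
         (i <= i')%N -> D i' j' <= D i j)].

Definition leading_left_singular_vectors (R : realType) q s (A : 'M[R]_(q, s))
    k (le_kq : (k <= q)%N) (V : 'M[R]_(q, k)) : Prop :=
  exists U D W, is_svd A U D W /\ V = colsub (widen_ord le_kq) U.

(* Product of a matrix with a column of functions. *)
Definition mul_mx_fun (R : realType) (X : Type) m n (A : 'M[R]_(m, n))
    (f : 'I_n -> X -> R) : 'I_m -> X -> R :=
  fun k => \sum_(i < n) A k i *: f i.

(* Main.v *)
Require Import Defs.
From mathcomp Require Import all_boot all_order all_algebra.
From mathcomp Require Import all_classical all_reals all_analysis.
From mathcomp Require Import measurable_realfun ring.

(** Everything is read off coordinates.  A function of S . Y with coefficient
    matrix M is represented by LY^T M LS, and since the mass matrices are
    LY LY^T and LS LS^T this makes the space-time L^2 inner product the Frobenius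
    inner product ([st_inner_coord]).  Let A represent x.

    A subspace W of Y whose basis has coefficient rows B in terms of nu makes
    S . W correspond to the matrices Q C, with Q = LY^T B^T of full column rank
    and C arbitrary.  The projection onto S . W is therefore A |-> P A, with
    P = Q (Q^T Q)^-1 Q^T the orthogonal projector on the column space of Q, and
    the squared error is |A|^2 - tr (P A A^T) ([st_error_coord]).  Minimizing the
    error amounts to maximizing tr (P G), where G = A A^T, over orthogonal
    projectors P of rank qhat.

    Diagonalize G = U diag(d) U^T with the singular value decomposition, d being
    the squared singular values in nonincreasing order.  Then tr (P G) is the sum
    of the d_i w_i, where the w_i are the diagonal entries of U^T P U; these lie
    in [0, 1] and add up to tr P = qhat, so the sum is at most that of the qhat
    largest d_i ([fan_trace]).  For the subspace built from V the matrix Q is V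
    itself, P is V V^T, and the bound is attained ([leading_sv_trace]). *)

Set Implicit Arguments.
Unset Strict Implicit.
Unset Printing Implicit Defensive.

Import Order.TTheory GRing.Theory Num.Theory.
Import numFieldNormedType.Exports.

Local Open Scope classical_set_scope.
Local Open Scope ring_scope.

(** * Orthogonal projectors and the Frobenius inner product *)

Section Frobenius.
Variable R : realFieldType.

Definition frob m n (A B : 'M[R]_(m, n)) : R := \tr (A *m B^T).

Lemma frobE m n (A B : 'M[R]_(m, n)) :
  frob A B = \sum_i \sum_j A i j * B i j.
Proof.
apply: eq_bigr => i _; rewrite mxE; apply: eq_bigr => j _.
by rewrite mxE.
Qed.

Lemma frob_eq0 m n (A : 'M[R]_(m, n)) : frob A A = 0 -> A = 0.
Proof.
rewrite frobE => /eqP; rewrite psumr_eq0; last first.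
  by move=> i _; apply: sumr_ge0 => j _; rewrite -expr2 sqr_ge0.
move/allP => h; apply/matrixP => i j; rewrite mxE.
have := h i (mem_index_enum _); rewrite /= psumr_eq0; last first.
  by move=> ? _; rewrite -expr2 sqr_ge0.
by move/allP/(_ j (mem_index_enum _)); rewrite /= mulf_eq0 orbb => /eqP.
Qed.

(** A row vector v killed by Q^T Q satisfies |v Q^T|^2 = 0, and Q^T is row free. *)
Lemma gram_unit m k (Q : 'M[R]_(m, k)) : row_free Q^T -> Q^T *m Q \in unitmx.
Proof.
move=> Qfree; rewrite -row_free_unit; apply/inj_row_free => v vQQ0.
have vQ0 : v *m Q^T = 0.
  apply: frob_eq0; rewrite /frob trmx_mul trmxK.
  by rewrite -mulmxA [Q^T *m _]mulmxA mulmxA vQQ0 mul0mx mxtrace0.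
by apply/eqP; rewrite -(mulmx_free_eq0 v Qfree) vQ0.
Qed.

Definition orthoproj_mx m k (Q : 'M[R]_(m, k)) : 'M[R]_m :=
  Q *m invmx (Q^T *m Q) *m Q^T.

Section orthoproj.
Variables (m k : nat) (Q : 'M[R]_(m, k)).
Hypothesis Qfree : row_free Q^T.

Lemma orthoproj_mx_tr : (orthoproj_mx Q)^T = orthoproj_mx Q.
Proof. by rewrite /orthoproj_mx !trmx_mul trmx_inv trmx_mul !trmxK mulmxA. Qed.

Lemma orthoproj_mxK : orthoproj_mx Q *m Q = Q.
Proof. by rewrite /orthoproj_mx -!mulmxA mulVmx ?gram_unit// mulmx1. Qed.

Lemma orthoproj_mx_id : orthoproj_mx Q *m orthoproj_mx Q = orthoproj_mx Q.
Proof. by rewrite {2}/orthoproj_mx !mulmxA orthoproj_mxK. Qed.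

(** The trace is the rank because Q can be moved around cyclically. *)
Lemma orthoproj_mx_trace : \tr (orthoproj_mx Q) = k%:R.
Proof.
by rewrite /orthoproj_mx mxtrace_mulC mulmxA mulmxV ?gram_unit// mxtrace1.
Qed.

End orthoproj.

(** Pythagoras: the part of A outside the range of P carries the Frobenius norm
    that P does not capture. *)
Lemma frob_residual m n (P : 'M[R]_m) (A : 'M[R]_(m, n)) :
  P^T = P -> P *m P = P ->
  frob (A - P *m A) (A - P *m A) = frob A A - \tr (P *m (A *m A^T)).
Proof.
move=> Ps Pi; have -> : A - P *m A = (1%:M - P) *m A by rewrite mulmxBl mul1mx.
have Cs : (1%:M - P)^T = 1%:M - P by rewrite linearB /= trmx1 Ps.
rewrite /frob trmx_mul mulmxA mxtrace_mulC Cs !mulmxA.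
rewrite -[_ *m _ *m (1%:M - P)]mulmxA.
have -> : (1%:M - P) *m (1%:M - P) = 1%:M - P.
  by rewrite mulmxBl !mulmxBr !mul1mx mulmx1 Pi subrr subr0.
by rewrite mxtrace_mulC mulmxA mulmxBr mulmx1 linearB /= -[P *m A *m _]mulmxA
  [\tr (P *m _)]mxtrace_mulC.
Qed.

Lemma frob_mull m k n (Q : 'M[R]_(m, k))
    (A : 'M[R]_(m, n)) (C : 'M[R]_(k, n)) :
  frob A (Q *m C) = frob (Q^T *m A) C.
Proof. by rewrite /frob trmx_mul mulmxA mxtrace_mulC mulmxA. Qed.

(** The normal equations determine the best approximation: testing the residual
    against Q Q^T times itself gives Q^T (A - Q C) = 0, hence P (A - Q C) = 0. *)
Lemma orthoproj_mx_eq m k n (Q : 'M[R]_(m, k))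
    (A : 'M[R]_(m, n)) (C : 'M[R]_(k, n)) : row_free Q^T ->
  (forall C', frob (A - Q *m C) (Q *m C') = 0) -> Q *m C = orthoproj_mx Q *m A.
Proof.
move=> Qfree orth.
have Qr0 : Q^T *m (A - Q *m C) = 0.
  by apply: frob_eq0; rewrite -frob_mull orth.
apply/eqP; rewrite eq_sym -subr_eq0 -{2}(orthoproj_mxK Qfree) -mulmxA -mulmxBr.
by rewrite /orthoproj_mx -[_ *m Q^T *m _]mulmxA Qr0 mulmx0.
Qed.

Lemma orthoproj_mx_orth m k n (Q : 'M[R]_(m, k))
    (A : 'M[R]_(m, n)) (C : 'M[R]_(k, n)) : row_free Q^T ->
  frob (A - orthoproj_mx Q *m A) (Q *m C) = 0.
Proof.
move=> Qfree; rewrite frob_mull.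
suff -> : Q^T *m (A - orthoproj_mx Q *m A) = 0 by rewrite /frob mul0mx mxtrace0.
rewrite mulmxBr mulmxA -{1}(orthoproj_mx_tr Q) -trmx_mul orthoproj_mxK//.
by rewrite subrr.
Qed.

(** With the threshold th = d_(k-1), each (d_i - th) ([i < k] - w_i) is
    nonnegative: both factors are nonnegative for i < k and nonpositive for
    i >= k.  The th terms cancel in the sum, as the w_i add up to k. *)
Lemma ler_sum_truncate n k (k_gt0 : (0 < k)%N) (le_kn : (k <= n)%N)
    (d w : 'I_n -> R) :
  (forall i j : 'I_n, (i <= j)%N -> d j <= d i) ->
  (forall i, 0 <= w i <= 1) -> \sum_i w i = k%:R ->
  \sum_i d i * w i <= \sum_(i < k) d (widen_ord le_kn i).
Proof.
move=> dmono w01 wk.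
have lt_pkn : (k.-1 < n)%N by rewrite prednK.
(* th is the smallest of the k leading values. *)
pose th := d (Ordinal lt_pkn).
have sumk (g : 'I_n -> R) :
    \sum_(i < k) g (widen_ord le_kn i) = \sum_(i < n) g i * (i < k)%:R.
  rewrite -(big_ord_narrow (F := g) le_kn) /= big_mkcond /=.
  apply: eq_bigr => i _.
  by case: ifP; rewrite ?mulr1 ?mulr0.
rewrite sumk -subr_ge0 -sumrB.
have : \sum_(i < n) th * ((i < k)%:R - w i) = 0.
  rewrite -mulr_sumr sumrB wk.
  have := sumk (fun=> 1); rewrite sumr_const card_ord => ->.
  by rewrite -sumrB big1 ?mulr0// => i _; rewrite mul1r subrr.
move=> thE; rewrite -[X in X <= _]thE; apply: ler_sum => i _; rewrite -mulrBr.
have /andP[w0 w1] := w01 i; rewrite -subr_ge0 -mulrBl.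
case: (ltnP i k) => ik.
  by rewrite mulr_ge0 ?subr_ge0// dmono//= -ltnS prednK.
rewrite mulr_le0 ?sub0r ?oppr_le0// subr_le0 dmono//=.
by rewrite (leq_trans _ ik)// leq_pred.
Qed.

(** P i i is the squared norm of the i-th column of P, and 1 - P is again an
    orthogonal projector. *)
Lemma sym_idem_diag m (P : 'M[R]_m) : P^T = P -> P *m P = P ->
  forall i, 0 <= P i i <= 1.
Proof.
have diag_ge0 (B : 'M[R]_m) i : B^T = B -> B *m B = B -> 0 <= B i i.
  move=> Bs Bi; rewrite -Bi mxE; apply: sumr_ge0 => j _.
  by rewrite -{2}Bs mxE -expr2 sqr_ge0.
move=> Ps Pi i; rewrite diag_ge0//=.
suff : 0 <= (1%:M - P) i i by rewrite !mxE eqxx mulr1n subr_ge0.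
apply: diag_ge0; first by rewrite linearB /= trmx1 Ps.
by rewrite mulmxBl !mulmxBr !mul1mx !mulmx1 Pi subrr subr0.
Qed.

(** Ky Fan maximum principle for orthogonal projectors: in the eigenbasis U the
    trace only sees the diagonal of U^T P U. *)
Lemma fan_trace n k (k_gt0 : (0 < k)%N) (le_kn : (k <= n)%N)
    (P U : 'M[R]_n) (d : 'rV[R]_n) :
  P^T = P -> P *m P = P -> \tr P = k%:R -> U^T *m U = 1%:M ->
  (forall i j : 'I_n, (i <= j)%N -> d 0 j <= d 0 i) ->
  \tr (P *m (U *m diag_mx d *m U^T)) <= \sum_(i < k) d 0 (widen_ord le_kn i).
Proof.
move=> Ps Pi Ptr UU dmono.
have UU' : U *m U^T = 1%:M by exact: mulmx1C.
pose w := U^T *m P *m U.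
have -> : \tr (P *m (U *m diag_mx d *m U^T)) = \sum_i d 0 i * w i i.
  rewrite mulmxA mxtrace_mulC !mulmxA -/w mul_mx_diag.
  by apply: eq_bigr => i _; rewrite mxE mulrC.
apply: ler_sum_truncate => //; last first.
  have -> : \sum_i w i i = \tr w by [].
  by rewrite /w mxtrace_mulC mulmxA UU' mul1mx.
apply: sym_idem_diag; first by rewrite /w !trmx_mul trmxK Ps mulmxA.
rewrite /w !mulmxA -[U^T *m P *m U *m U^T]mulmxA UU' mulmx1.
by rewrite -[U^T *m P *m P]mulmxA Pi.
Qed.

End Frobenius.

(** * The Gram matrix of a singular value decomposition *)

Section svd.
Variable R : realType.

(** For the diagonal factor D of a singular value decomposition, these are the
    squared singular values, padded with zeros up to length q when s < q. *)
Definition sqsv q s (D : 'M[R]_(q, s)) : 'rV[R]_q :=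
  \row_i \sum_j D i j ^+ 2.

Section svd_data.
Variables (q s : nat) (A : 'M[R]_(q, s)) (U : 'M[R]_q) (D : 'M[R]_(q, s))
  (W : 'M[R]_s).
Hypothesis svdA : is_svd A U D W.

Lemma svd_gram : A *m A^T = U *m diag_mx (sqsv D) *m U^T.
Proof.
case: svdA => -> _ WW Ddiag _.
rewrite !trmx_mul trmxK !mulmxA -[X in X *m D^T]mulmxA WW mulmx1.
rewrite -[U *m D *m D^T]mulmxA; congr (_ *m _ *m _).
apply/matrixP => i j; rewrite !mxE; have [<-{j}|ij] := eqVneq i j.
  by rewrite mulr1n; apply: eq_bigr => l _; rewrite mxE expr2.
rewrite mulr0n big1// => l _; rewrite mxE.
have [il|il] := eqVneq (i : nat) l; last by rewrite [D i l]Ddiag// mul0r.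
by rewrite [D j l]Ddiag ?mulr0// -il eq_sym.
Qed.

Lemma sqsv_noninc (i j : 'I_q) : (i <= j)%N -> sqsv D 0 j <= sqsv D 0 i.
Proof.
case: svdA => _ _ _ Ddiag [D0 Dmono] ij; rewrite !mxE.
have sqge0 (l : 'I_q) : 0 <= \sum_j0 D l j0 ^+ 2.
  by apply: sumr_ge0 => ? _; exact: sqr_ge0.
have [js|sj] := ltnP j s; last first.
  rewrite big1// => l _; rewrite Ddiag ?expr0n// gtn_eqF//.
  exact: leq_trans (ltn_ord l) sj.
have sqE (l : 'I_q) (ls : (l < s)%N) :
    \sum_j0 D l j0 ^+ 2 = D l (Ordinal ls) ^+ 2.
  rewrite (bigD1 (Ordinal ls))//= big1 ?addr0// => m ml.
  by rewrite Ddiag ?expr0n//; apply: contra ml => /eqP lm; apply/eqP/val_inj.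
rewrite !sqE ?(leq_ltn_trans ij)// => is_.
by rewrite ler_pXn2r ?nnegrE// Dmono.
Qed.

Lemma leading_sv_orthonormal k (le_kq : (k <= q)%N) :
  let V := colsub (widen_ord le_kq) U in V^T *m V = 1%:M.
Proof.
case: svdA => _ UU _ _ _ /=.
apply/matrixP => i j; pose w := widen_ord le_kq.
have := congr1 (fun B : 'M[R]_q => B (w i) (w j)) UU.
rewrite !mxE => <- //=; apply: eq_bigr => l _; by rewrite !mxE.
Qed.

(** The bound of [fan_trace] is attained by the projector on the leading left
    singular vectors, since U^T V selects the first k coordinates. *)
Lemma leading_sv_trace k (le_kq : (k <= q)%N) :
  let V := colsub (widen_ord le_kq) U in
  \tr (V *m V^T *m (A *m A^T)) = \sum_(i < k) sqsv D 0 (widen_ord le_kq i).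
Proof.
case: (svdA) => _ UU _ _ _ V.
have UV i j : (U^T *m V) i j = (i == widen_ord le_kq j)%:R.
  have := congr1 (fun B : 'M[R]_q => B i (widen_ord le_kq j)) UU.
  rewrite !mxE => <- //=; apply: eq_bigr => l _; by rewrite !mxE.
rewrite -mulmxA mxtrace_mulC svd_gram.
have -> : V^T *m (U *m diag_mx (sqsv D) *m U^T) *m V =
    (U^T *m V)^T *m (diag_mx (sqsv D) *m (U^T *m V)).
  by rewrite trmx_mul trmxK !mulmxA.
apply: eq_bigr => i _; rewrite mxE (bigD1 (widen_ord le_kq i))//= big1.
  by rewrite mxE UV eqxx mul_diag_mx mxE UV eqxx mulr1 mul1r addr0.
by move=> j ji; rewrite mxE UV (negPf ji) mul0r.
Qed.

End svd_data.
End svd.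

(** * Finite-dimensional subspaces of L^2 *)

Section L2_theory.
Context d (X : measurableType d) (R : realType).
Variable mu : {measure set X -> \bar R}.
Local Notation L2 := (L2 mu).
Local Notation L2inner := (L2inner mu).
Implicit Types f g : X -> R.

Lemma sum_funE (I : finType) (F : I -> X -> R) t :
  (\sum_i F i) t = \sum_i F i t.
Proof. by rewrite fct_sumE. Qed.

Lemma lin_combE (I : finType) (c : I -> R) (e : I -> X -> R) t :
  (\sum_i c i *: e i) t = \sum_i c i * e i t.
Proof. by rewrite fct_sumE. Qed.

Lemma ae_eq_sum (I : finType) (F G : I -> X -> R) :
  (forall i, F i = G i %[ae mu]) -> \sum_i F i = \sum_i G i %[ae mu].
Proof.
move=> FG; have : \forall t \ae mu, forall i, F i t = G i t.
  by apply: filter_forall => i; have := FG i; apply: filterS => t; exact.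
by apply: filterS => t FGt _; rewrite !fct_sumE; apply: eq_bigr => i _.
Qed.

Lemma ae_eqZ a f g : f = g %[ae mu] -> a *: f = a *: g %[ae mu].
Proof. by apply: filterS => t /(_ I) fg _; rewrite /GRing.scale /= fg. Qed.

Lemma ae_eqB f f' g g' : f = f' %[ae mu] -> g = g' %[ae mu] ->
  f - g = f' - g' %[ae mu].
Proof. by apply: filterS2 => t /(_ I) fg /(_ I) fg' _; rewrite !fctE fg fg'. Qed.

Lemma L2_measurable f : L2 f -> measurable_fun setT f.
Proof. by move/sub_Lfun_mfun; rewrite inE. Qed.

Let lin_closed := @Lfun_submod_closed _ X R mu 2%:E (lee1n 2).

Lemma L2Z a f : L2 f -> L2 (a *: f).
Proof.
move=> Lf; rewrite -[_ *: _]addr0; apply: lin_closed.2 => //.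
exact: lin_closed.1.
Qed.

Lemma L2D f g : L2 f -> L2 g -> L2 (f + g).
Proof. by move=> Lf Lg; rewrite -[f]scale1r; exact: lin_closed.2. Qed.

Lemma L2B f g : L2 f -> L2 g -> L2 (f - g).
Proof. by move=> Lf Lg; rewrite -scaleN1r; apply: L2D => //; exact: L2Z. Qed.

Lemma L2_sum (I : finType) (F : I -> X -> R) :
  (forall i, L2 (F i)) -> L2 (\sum_i F i).
Proof.
move=> LF; elim/big_ind: _ => //; first exact: lin_closed.1.
exact: L2D.
Qed.

Lemma L2_integrable_mul f g : L2 f -> L2 g ->
  mu.-integrable setT (EFin \o (fun t => f t * g t)).
Proof. by move=> Lf Lg; apply/Lfun1_integrable; exact: Lfun2_mul_Lfun1. Qed.

Lemma L2inner_ae f f' g g' : L2 f -> L2 f' -> L2 g -> L2 g' ->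
  f = f' %[ae mu] -> g = g' %[ae mu] -> L2inner f g = L2inner f' g'.
Proof.
move=> Lf Lf' Lg Lg' ff' gg'; congr fine; apply: ae_eq_integral => //.
- exact: measurable_int (L2_integrable_mul Lf Lg).
- exact: measurable_int (L2_integrable_mul Lf' Lg').
by move: ff' gg'; apply: filterS2 => t /(_ I) -> /(_ I) ->.
Qed.

Lemma L2inner_sym f g : L2inner f g = L2inner g f.
Proof. by congr fine; apply: eq_integral => t _; rewrite mulrC. Qed.

Lemma L2innerDl f g h : L2 f -> L2 g -> L2 h ->
  L2inner (f + g) h = L2inner f h + L2inner g h.
Proof.
move=> Lf Lg Lh; rewrite /L2inner -RintegralD ?(L2_integrable_mul _ _)//.
by congr fine; apply: eq_integral => t _; rewrite fctE mulrDl.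
Qed.

Lemma L2innerZl a f g : L2 f -> L2 g ->
  L2inner (a *: f) g = a * L2inner f g.
Proof.
move=> Lf Lg; rewrite /L2inner -RintegralZl ?(L2_integrable_mul _ _)//.
by congr fine; apply: eq_integral => t _; rewrite mulrA.
Qed.

Lemma L2inner_suml (I : finType) (F : I -> X -> R) g :
  (forall i, L2 (F i)) -> L2 g ->
  L2inner (\sum_i F i) g = \sum_i L2inner (F i) g.
Proof.
move=> LF Lg.
suff : L2 (\sum_i F i) /\ L2inner (\sum_i F i) g = \sum_i L2inner (F i) g by case.
elim/big_rec2: _ => [|i y f _ [Lf <-]].
  split; first exact: lin_closed.1.
  by rewrite /L2inner /Rintegral integral0_eq// => t _; rewrite mul0r.
by split; [exact: L2D|rewrite L2innerDl].
Qed.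

Lemma L2inner_comb (I J : finType) (a : I -> R) (b : J -> R)
    (e : I -> X -> R) (h : J -> X -> R) :
  (forall i, L2 (e i)) -> (forall j, L2 (h j)) ->
  L2inner (\sum_i a i *: e i) (\sum_j b j *: h j) =
  \sum_i \sum_j a i * b j * L2inner (e i) (h j).
Proof.
move=> Le Lh; have Lb : L2 (\sum_j b j *: h j) by apply: L2_sum => j; exact: L2Z.
rewrite L2inner_suml//; last by move=> i; exact: L2Z.
apply: eq_bigr => i _; rewrite L2innerZl// L2inner_sym L2inner_suml//; last first.
  by move=> j; exact: L2Z.
rewrite mulr_sumr; apply: eq_bigr => j _.
by rewrite L2innerZl// L2inner_sym mulrA.
Qed.

Lemma L2inner_eq0 f : L2 f -> L2inner f f = 0 -> f = 0 %[ae mu].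
Proof.
move=> Lf ff0; have If := L2_integrable_mul Lf Lf.
have : (\int[mu]_t `|(f t * f t)%:E| = 0)%E.
  under eq_integral do rewrite gee0_abs ?lee_fin -?expr2 ?sqr_ge0//.
  rewrite -[LHS]fineK; last exact: (integrable_fin_num measurableT If).
  by under eq_integral do rewrite expr2; congr EFin.
move/(ae_eq_integral_abs mu measurableT (measurable_int _ If)).
apply: filterS => t /(_ I) [/eqP]; rewrite mulf_eq0 orbb => /eqP ft0 _.
by rewrite ft0.
Qed.

(** Allows any finite index type, such as pairs of indices, for the linear
    combination. *)
Lemma L2span_comb (A : set (X -> R)) (I : finType) (c : I -> R)
    (g : I -> X -> R) f :
  L2 f -> (forall i, A (g i)) -> f = \sum_i c i *: g i %[ae mu] ->
  L2span mu A f.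
Proof.
move=> Lf Ag fE; split=> //.
exists #|I|, (fun i => c (enum_val i)), (fun i => g (enum_val i)); split=> //.
by rewrite -(big_enum_val (A := I) (fun i => c i *: g i)).
Qed.

Lemma L2span_rangeP n (e : 'I_n -> X -> R) f :
  L2span mu (range e) f <->
  L2 f /\ exists b : 'rV[R]_n, f = \sum_i b 0 i *: e i %[ae mu].
Proof.
split=> [[Lf [m [c [g [ge fE]]]]]|[Lf [b fE]]]; last first.
  by apply: L2span_comb fE => // i; exists i.
split=> //.
have /choice[r rE] : forall i, exists j, e j = g i.
  by move=> i; have [j _ <-] := ge i; exists j.
exists (\row_j \sum_(i | r i == j) c i).
suff -> : \sum_j (\row_j \sum_(i | r i == j) c i) 0 j *: e j =
  \sum_i c i *: g i by [].
rewrite [RHS](partition_big r xpredT)//=; apply: eq_bigr => j _.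
rewrite mxE scaler_suml; apply: eq_bigr => i /eqP <-.
by rewrite rE.
Qed.

(** v M v^T is the squared L^2 norm of the combination of the e_i with
    coefficients v, so that M has a trivial kernel. *)
Lemma L2_mass_unit n (e : 'I_n -> X -> R) :
  (forall i, L2 (e i)) -> L2free mu e -> mass_matrix mu e \in unitmx.
Proof.
move=> Le efree; rewrite -row_free_unit; apply/inj_row_free => v vM0.
apply/rowP => i; rewrite mxE; apply: (efree (v 0)).
apply: L2inner_eq0; first by apply: L2_sum => j; exact: L2Z.
rewrite L2inner_comb//.
transitivity ((v *m mass_matrix mu e *m v^T) 0 0); last first.
  by rewrite vM0 mul0mx mxE.
rewrite mxE exchange_big /=; apply: eq_bigr => j _.
by rewrite !mxE mulr_suml; apply: eq_bigr => k _; rewrite !mxE mulrAC.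
Qed.

Lemma mul_mx_funA m n p (A : 'M[R]_(m, n)) (B : 'M[R]_(n, p))
    (e : 'I_p -> X -> R) :
  mul_mx_fun A (mul_mx_fun B e) = mul_mx_fun (A *m B) e.
Proof.
apply/funext => k; rewrite /mul_mx_fun.
under eq_bigr do rewrite scaler_sumr.
rewrite exchange_big /=; apply: eq_bigr => i _; rewrite mxE scaler_suml.
by apply: eq_bigr => j _; rewrite scalerA.
Qed.

Lemma lin_comb_mul_mx_fun m n (b : 'rV[R]_m) (B : 'M[R]_(m, n))
    (e : 'I_n -> X -> R) :
  \sum_l b 0 l *: mul_mx_fun B e l = \sum_i (b *m B) 0 i *: e i.
Proof. exact: (congr1 (fun h => h 0) (mul_mx_funA b B e)). Qed.

(** The coordinate map in the free family e is injective, so independence of the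
    f_l is independence of their coordinate rows. *)
Lemma mul_mx_fun_free m n (B : 'M[R]_(m, n)) (e : 'I_n -> X -> R)
    (f : 'I_m -> X -> R) :
  L2free mu e -> (forall l, f l = mul_mx_fun B e l %[ae mu]) ->
  L2free mu f <-> row_free B.
Proof.
move=> efree fE.
have combE (c : 'rV[R]_m) :
    \sum_l c 0 l *: f l = \sum_i (c *m B) 0 i *: e i %[ae mu].
  by rewrite -lin_comb_mul_mx_fun; apply: ae_eq_sum => l; exact: ae_eqZ.
split=> [ffree|Bfree c c0 l].
  apply/inj_row_free => v vB0; apply/rowP => i; rewrite mxE.
  apply: (ffree (v 0)); apply: ae_eq_trans (combE v) _.
  rewrite vB0 big1 => [|j _]; first exact: ae_eq_refl.
  by rewrite mxE scale0r.
pose v := \row_l c l.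
have vB0 : v *m B = 0.
  apply/rowP => i; rewrite [RHS]mxE; apply: (efree ((v *m B) 0)).
  apply: ae_eq_trans (ae_eq_sym (combE v)) _.
  by under eq_bigr do rewrite mxE.
have v0 := row_free_inj Bfree (etrans vB0 (esym (mul0mx _ B))).
have := congr1 (fun w : 'rV[R]_m => w 0 l) v0.
by rewrite !mxE.
Qed.

Lemma L2_integrableP (f : X -> R) : measurable_fun setT f ->
  L2 f <-> mu.-integrable setT (EFin \o (fun t => f t ^+ 2)).
Proof.
move=> mf; split; first exact: Lfun2_integrable_sqr.
move=> If; apply/andP; split; rewrite inE//=.
have /integrableP[_] := If.
rewrite /finite_norm unlock => oo; rewrite poweR_lty//.
rewrite (eq_integral (fun t => `|(f t ^+ 2)%:E|%E))// => t _.
by rewrite /= normrX powR_mulrn.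
Qed.

Lemma L2span_range_mem n (e : 'I_n -> X -> R) i :
  L2 (e i) -> L2span mu (range e) (e i).
Proof.
move=> Le; split=> //; exists 1%N, (fun=> 1), (fun=> e i).
split; first by move=> _; exists i.
by rewrite big_ord1 scale1r; exact: ae_eq_refl.
Qed.

End L2_theory.

(** * Products of functions of space and time *)

Section spacetime_theory.
Context d (X : measurableType d) d' (Z : measurableType d') (R : realType).
Variable mu : {sigma_finite_measure set X -> \bar R}.
Variable tau : {sigma_finite_measure set Z -> \bar R}.
Local Notation mutau := (mu \x tau)%E.

Lemma ae_product1 (P : X -> Prop) :
  (\forall t \ae mu, P t) -> \forall z \ae mutau, P z.1.
Proof.
move=> [N [mN N0 NP]]; exists (N `*` setT); split.
- exact: measurableX.
- apply: (etrans (product_measure1E mu tau mN measurableT)).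
  by apply/eqP; rewrite mule_eq0; apply/orP; left; exact/eqP.
- by move=> z /= nP; split=> //; exact: NP.
Qed.

Lemma ae_product2 (P : Z -> Prop) :
  (\forall t \ae tau, P t) -> \forall z \ae mutau, P z.2.
Proof.
move=> [N [mN N0 NP]]; exists (setT `*` N); split.
- exact: measurableX.
- apply: (etrans (product_measure1E mu tau measurableT mN)).
  by apply/eqP; rewrite mule_eq0; apply/orP; right; exact/eqP.
- by move=> z /= nP; split=> //; exact: NP.
Qed.

Lemma st_mul_ae (y y' : X -> R) (p p' : Z -> R) :
  y = y' %[ae mu] -> p = p' %[ae tau] -> st_mul y p = st_mul y' p' %[ae mutau].
Proof.
move=> /ae_product1 + /ae_product2.
by apply: filterS2 => z /(_ I) yy /(_ I) pp _; rewrite /st_mul yy pp.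
Qed.

(** Fubini; the inner integrals of f g over space are finite for almost every
    time, so converting them to real numbers loses nothing. *)
Lemma st_innerE (f g : X * Z -> R) : L2 mutau f -> L2 mutau g ->
  st_inner mu tau f g = L2inner mutau f g.
Proof.
move=> Lf Lg; have Ifg := L2_integrable_mul Lf Lg.
rewrite /L2inner /Rintegral -integral21_prod_meas1// /st_inner /Rintegral.
congr fine; apply: ae_eq_integral => //.
- apply/measurable_EFinP; apply: measurableT_comp => //.
  exact: (measurable_fubini_G Ifg).
- exact: (measurable_fubini_G Ifg).
have := ae_integrable2 Ifg; apply: filterS => t It _.
by rewrite /fubini_G fineK//; exact: integrable_fin_num It.
Qed.

(** Tonelli: the integral of the square factors. *)
Lemma L2_st_mul (y : X -> R) (p : Z -> R) :
  L2 mu y -> L2 tau p -> L2 mutau (st_mul y p).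
Proof.
move=> Ly Lp.
have mst : measurable_fun setT (st_mul y p).
  apply: measurable_funM.
    exact: measurableT_comp (L2_measurable Ly) measurable_fst.
  exact: measurableT_comp (L2_measurable Lp) measurable_snd.
apply/L2_integrableP => //.
apply/integrable21ltyP.
  by apply/measurable_EFinP; exact: measurable_funX.
have /integrableP[my2 yoo] := (L2_integrableP _ (L2_measurable Ly)).1 Ly.
have /integrableP[mp2 poo] := (L2_integrableP _ (L2_measurable Lp)).1 Lp.
rewrite (eq_integral (fun t => (\int[mu]_x `|(y x ^+ 2)%:E|) *
    `|(p t ^+ 2)%:E|)%E) => [|t _].
  rewrite ge0_integralZl ?lte_mul_pinfty ?integral_ge0//.
    by rewrite ge0_fin_numE ?integral_ge0.
  exact: measurableT_comp.
rewrite muleC -ge0_integralZl//; last exact: measurableT_comp.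
by apply: eq_integral => x _; rewrite /= /st_mul exprMn normrM mulrC.
Qed.

Lemma L2inner_st_mul (y y' : X -> R) (p p' : Z -> R) :
  L2 mu y -> L2 mu y' -> L2 tau p -> L2 tau p' ->
  L2inner mutau (st_mul y p) (st_mul y' p') = L2inner mu y y' * L2inner tau p p'.
Proof.
move=> Ly Ly' Lp Lp'; rewrite -st_innerE; [|exact: L2_st_mul..].
rewrite /st_inner /L2inner -RintegralZl ?L2_integrable_mul//.
apply: eq_Rintegral => t _; rewrite -RintegralZr ?L2_integrable_mul//.
by apply: eq_Rintegral => x _; rewrite /st_mul mulrACA.
Qed.

Section combinations.
Variables (q s : nat) (nu : 'I_q -> X -> R) (psi : 'I_s -> Z -> R).

Definition st_comb (M : 'M[R]_(q, s)) : X * Z -> R :=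
  \sum_j \sum_i M i j *: st_mul (nu i) (psi j).

Lemma st_combB M N : st_comb (M - N) = st_comb M - st_comb N.
Proof.
rewrite /st_comb -sumrB; apply: eq_bigr => j _.
by rewrite -sumrB; apply: eq_bigr => i _; rewrite !mxE scalerBl.
Qed.

Lemma st_comb_pair M : st_comb M =
  \sum_(u : 'I_q * 'I_s) M u.1 u.2 *: st_mul (nu u.1) (psi u.2).
Proof. by rewrite /st_comb exchange_big pair_bigA. Qed.

Lemma st_comb_rank1 (b : 'rV[R]_q) (c : 'rV[R]_s) :
  st_mul (\sum_i b 0 i *: nu i) (\sum_j c 0 j *: psi j) = st_comb (b^T *m c).
Proof.
apply/funext => z; rewrite /st_comb [RHS]sum_funE {1}/st_mul !lin_combE.
rewrite mulr_sumr; apply: eq_bigr => j _.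
rewrite lin_combE mulr_suml; apply: eq_bigr => i _.
by rewrite mxE big_ord1 mxE mulrACA.
Qed.

Lemma st_comb_sum (I : finType) (c : I -> R) (M : I -> 'M[R]_(q, s)) :
  \sum_i c i *: st_comb (M i) = st_comb (\sum_i c i *: M i).
Proof.
under eq_bigr do rewrite scaler_sumr; rewrite exchange_big.
apply: eq_bigr => j _; under eq_bigr do rewrite scaler_sumr.
rewrite exchange_big; apply: eq_bigr => i _; rewrite summxE scaler_suml.
by apply: eq_bigr => k _; rewrite mxE scalerA.
Qed.

Hypotheses (Lnu : forall i, L2 mu (nu i)) (Lpsi : forall j, L2 tau (psi j)).

Lemma L2_st_comb M : L2 mutau (st_comb M).
Proof. by do 2!apply: L2_sum => ?; apply/L2Z/L2_st_mul. Qed.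

Lemma L2inner_st_comb M N : L2inner mutau (st_comb M) (st_comb N) =
  \tr (mass_matrix mu nu *m M *m mass_matrix tau psi *m N^T).
Proof.
have -> : \tr (mass_matrix mu nu *m M *m mass_matrix tau psi *m N^T) =
    \sum_k \sum_l (\sum_j (\sum_i mass_matrix mu nu k i * M i j) *
      mass_matrix tau psi j l) * N k l.
  apply: eq_bigr => k _; rewrite mxE; apply: eq_bigr => l _.
  rewrite !mxE; congr (_ * _); apply: eq_bigr => j _; by rewrite mxE.
rewrite !st_comb_pair L2inner_comb; [|by move=> u; exact: L2_st_mul..].
rewrite exchange_big [RHS]pair_bigA; apply: eq_bigr => -[k l] _ /=.
rewrite mulr_suml [RHS](eq_bigr (fun j => \sum_i (mass_matrix mu nu k i * M i j) *
      mass_matrix tau psi j l * N k l)); last by move=> j _; rewrite !mulr_suml.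
rewrite exchange_big [RHS]pair_bigA; apply: eq_bigr => -[i j] _ /=.
by rewrite L2inner_st_mul// !mxE [L2inner mu (nu k) _]L2inner_sym; ring.
Qed.

End combinations.

Section spans.
Variables (q s k : nat) (nu : 'I_q -> X -> R) (psi : 'I_s -> Z -> R)
  (f : 'I_k -> X -> R) (B : 'M[R]_(k, q)).
Hypotheses (Lnu : forall i, L2 mu (nu i)) (Lpsi : forall j, L2 tau (psi j)).
Hypotheses (Lf : forall l, L2 mu (f l))
  (fE : forall l, f l = mul_mx_fun B nu l %[ae mu]).

Lemma st_comb_base C : st_comb f psi C = st_comb nu psi (B^T *m C) %[ae mutau].
Proof.
have -> : st_comb nu psi (B^T *m C) = st_comb (mul_mx_fun B nu) psi C.
  apply: eq_bigr => j _; apply/funext => z; rewrite !lin_combE.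
  under eq_bigr do rewrite mxE mulr_suml.
  rewrite exchange_big; apply: eq_bigr => l _ /=.
  rewrite /st_mul /mul_mx_fun lin_combE mulr_suml mulr_sumr.
  by apply: eq_bigr => i _; rewrite mxE; ring.
apply: ae_eq_sum => j; apply: ae_eq_sum => l; apply: ae_eqZ.
by apply: st_mul_ae => //; exact: ae_eq_refl.
Qed.

(** Expressing the basis of W through nu puts all the spaces S . W in one
    common coordinate space, where S . W consists of the matrices B^T C. *)
Lemma st_spaceP z :
  st_space mu tau (L2span tau (range psi)) (L2span mu (range f)) z <->
  L2 mutau z /\ exists C, z = st_comb nu psi (B^T *m C) %[ae mutau].
Proof.
split=> [[Lz [n [c [g [gP zE]]]]]|[Lz [C zE]]].
  split=> //.
  have /choice[C CE] : forall i, exists C, g i = st_comb f psi C %[ae mutau].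
    move=> i; have [y [p [/L2span_rangeP[_ [b yE]] /L2span_rangeP[_ [a pE]] ->]]] := gP i.
    exists (b^T *m a); rewrite -st_comb_rank1; exact: st_mul_ae.
  exists (\sum_i c i *: C i); apply: ae_eq_trans zE _.
  apply: ae_eq_trans (st_comb_base _).
  by rewrite -st_comb_sum; apply: ae_eq_sum => i; exact: ae_eqZ.
apply: (@L2span_comb _ _ _ _ _ ('I_k * 'I_s)%type (fun u => C u.1 u.2)
  (fun u => st_mul (f u.1) (psi u.2))) => //.
  move=> u; exists (f u.1), (psi u.2); split=> //; apply: L2span_range_mem => //.
rewrite -st_comb_pair; apply: ae_eq_trans zE _.
exact: ae_eq_sym (st_comb_base _).
Qed.

End spans.

End spacetime_theory.

(** * The projection error in coordinates *)

Section error.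
Context d (X : measurableType d) d' (Z : measurableType d') (R : realType).
Variable mu : {sigma_finite_measure set X -> \bar R}.
Variable tau : {sigma_finite_measure set Z -> \bar R}.
Local Notation mutau := (mu \x tau)%E.
Variables (q s : nat) (nu : 'I_q -> X -> R) (psi : 'I_s -> Z -> R).
Hypotheses (Lnu : forall i, L2 mu (nu i)) (Lpsi : forall j, L2 tau (psi j)).
Variables (LY : 'M[R]_q) (LS : 'M[R]_s).
Hypotheses (LYfactor : mass_matrix mu nu = LY *m LY^T)
  (LSfactor : mass_matrix tau psi = LS *m LS^T).

(** The trace of M_Y M M_S M'^T becomes a Frobenius product after splitting both
    mass matrices into their factors and rotating LY under the trace. *)
Lemma st_inner_coord z z' M M' : L2 mutau z -> L2 mutau z' ->
  z = st_comb nu psi M %[ae mutau] -> z' = st_comb nu psi M' %[ae mutau] ->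
  st_inner mu tau z z' = frob (LY^T *m M *m LS) (LY^T *m M' *m LS).
Proof.
move=> Lz Lz' zM z'M'; rewrite st_innerE//.
rewrite (L2inner_ae Lz (L2_st_comb Lnu Lpsi M) Lz' (L2_st_comb Lnu Lpsi M'))//.
rewrite L2inner_st_comb// LYfactor LSfactor /frob !trmx_mul trmxK.
by rewrite -!mulmxA mxtrace_mulC !mulmxA.
Qed.

Section projection_error.
Variables (k : nat) (f : 'I_k -> X -> R) (B : 'M[R]_(k, q)).
Hypotheses (Lf : forall l, L2 mu (f l))
  (fE : forall l, f l = mul_mx_fun B nu l %[ae mu]) (Bfree : row_free B).
Hypotheses (LYunit : LY \in unitmx) (LSunit : LS \in unitmx).
Let Q := LY^T *m B^T.
Let V := st_space mu tau (L2span tau (range psi)) (L2span mu (range f)).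

Let Qfree : row_free Q^T.
Proof.
by rewrite /Q trmx_mul !trmxK /row_free mxrankMfree// row_free_unit.
Qed.

(** Existence of a projection is shown by exhibiting the function with
    representing matrix P A; conversely the normal equations force this matrix
    on the representative that [st_proj] picks. *)
Lemma st_error_coord x M : L2 mutau x -> x = st_comb nu psi M %[ae mutau] ->
  let A := LY^T *m M *m LS in
  st_norm mu tau (x - st_proj mu tau V x) =
  Num.sqrt (frob A A - \tr (orthoproj_mx Q *m (A *m A^T))).
Proof.
move=> Lx xM A.
have inner_res p C C' v : L2 mutau p -> L2 mutau v ->
    p = st_comb nu psi (B^T *m C) %[ae mutau] -> v = st_comb nu psi C' %[ae mutau] ->
    st_inner mu tau (x - p) v = frob (A - Q *m (C *m LS)) (LY^T *m C' *m LS).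
  move=> Lp Lv pC vC.
  rewrite (@st_inner_coord _ _ (M - B^T *m C) C')//; first last.
  - by rewrite st_combB; exact: ae_eqB.
  - exact: L2B.
  by rewrite mulmxBr mulmxBl /Q !mulmxA.
have [VP PV] : (forall v, V v -> L2 mutau v /\
    exists C, v = st_comb nu psi (B^T *m C) %[ae mutau]) /\
    (forall v C, L2 mutau v -> v = st_comb nu psi (B^T *m C) %[ae mutau] -> V v).
  split=> [v /(st_spaceP Lpsi Lf fE)//|v C Lv vC].
  by apply/(st_spaceP Lpsi Lf fE); split=> //; exists C.
have exproj : exists p, is_st_proj mu tau V x p.
  (* Chosen so that Q C LS = P A. *)
  pose C := invmx (Q^T *m Q) *m Q^T *m A *m invmx LS.
  exists (st_comb nu psi (B^T *m C)); split.
    by apply: PV (ae_eq_refl _ _ _); exact: L2_st_comb.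
  move=> v /VP[Lv [C' vC']].
  rewrite (inner_res _ C _ _ (L2_st_comb Lnu Lpsi _) Lv (ae_eq_refl _ _ _) vC').
  have -> : Q *m (C *m LS) = orthoproj_mx Q *m A 
    by rewrite /C mulmxKV// /orthoproj_mx !mulmxA.
  have -> : LY^T *m (B^T *m C') *m LS = Q *m (C' *m LS)
    by rewrite /Q !mulmxA.
  exact: orthoproj_mx_orth.
have [/VP[Lp [C pC]] p_orth] := xgetPex 0 exproj.
set p := xget _ _ in Lp pC p_orth.
have QC : Q *m (C *m LS) = orthoproj_mx Q *m A.
  apply: orthoproj_mx_eq => // C'.
  have Lv := L2_st_comb Lnu Lpsi (B^T *m (C' *m invmx LS)).
  have /p_orth : V (st_comb nu psi (B^T *m (C' *m invmx LS))).
    exact: PV (ae_eq_refl _ _ _).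
  rewrite (inner_res _ _ _ _ Lp Lv pC (ae_eq_refl _ _ _)) => <-.
  by rewrite /Q !mulmxA mulmxKV.
rewrite /st_norm; congr Num.sqrt.
have pE : x - p = st_comb nu psi (M - B^T *m C) %[ae mutau].
  by rewrite st_combB; exact: ae_eqB.
rewrite (inner_res p C (M - B^T *m C))//; last exact: L2B.
have -> : LY^T *m (M - B^T *m C) *m LS = A - Q *m (C *m LS).
  by rewrite mulmxBr mulmxBl /Q !mulmxA.
by rewrite QC frob_residual ?orthoproj_mx_tr ?orthoproj_mx_id.
Qed.

End projection_error.
End error.

Theorem lemma2p5 (R : realType) (T : R) (T_gt0 : 0 < T)
  (n : nat) (Omega : set (n.-tuple (measurableTypeR R)))
  (mOmega : measurable Omega)
  (s q : nat)
  (psi : 'I_s -> measurableTypeR R -> R)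
  (nu : 'I_q -> n.-tuple (measurableTypeR R) -> R)
  (S : set (measurableTypeR R -> R))
  (Y : set (n.-tuple (measurableTypeR R) -> R))
  (S_basis : L2basis (time_measure T) S psi)
  (Y_basis : L2basis (space_measure mOmega) Y nu)
  (LS : 'M[R]_s) (LY : 'M[R]_q)
  (LS_factor : mass_matrix (time_measure T) psi = LS *m LS^T)
  (LY_factor : mass_matrix (space_measure mOmega) nu = LY *m LY^T)
  (x : n.-tuple (measurableTypeR R) * measurableTypeR R -> R)
  (x_SY : st_space (space_measure mOmega) (time_measure T) S Y x)
  (X : 'M[R]_(q, s))
  (X_coef : st_coefficients (space_measure mOmega) (time_measure T) nu psi x X)
  (qhat : nat) (qhat_gt0 : (1 <= qhat)%N) (qhat_le_q : (qhat <= q)%N)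
  (V : 'M[R]_(q, qhat))
  (V_lead : leading_left_singular_vectors (LY^T *m X *m LS) qhat_le_q V) :
  let muO := space_measure mOmega in
  let muT := time_measure T in
  let error W := st_norm muO muT (x - st_proj muO muT (st_space muO muT S W) x) in
  let Yhat := L2span muO (range (mul_mx_fun (V^T *m invmx LY) nu)) in
  [/\ Yhat `<=` Y,
      L2subspace_dim muO Yhat qhat &
      forall W, W `<=` Y -> L2subspace_dim muO W qhat -> error Yhat <= error W].
Proof.
case: S_basis => Lpsi psi_free SE; case: Y_basis => Lnu nu_free YE.
subst S Y => muO muT error Yhat.
have factor_unit r (L N : 'M[R]_r) : N \in unitmx -> N = L *m L^T -> L \in unitmx.
  by move=> + NE; rewrite NE unitmx_mul => /andP[].
have LYunit := factor_unit _ _ _ (L2_mass_unit Lnu nu_free) LY_factor.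
have LSunit := factor_unit _ _ _ (L2_mass_unit Lpsi psi_free) LS_factor.
have [Lx _] := x_SY.
case: V_lead => U [D [P [svdA VE]]].
have VV : V^T *m V = 1%:M by rewrite VE; exact: (leading_sv_orthonormal svdA).
set A := LY^T *m X *m LS in svdA.
pose nuhat := mul_mx_fun (V^T *m invmx LY) nu.
have Lnuhat l : L2 muO (nuhat l) by apply: L2_sum => i; exact: L2Z.
have Vfree : row_free V^T.
  by apply/row_freeP; exists V.
have Bfree : row_free (V^T *m invmx LY).
  by rewrite /row_free mxrankMfree// row_free_unit unitmx_inv.
split.
- move=> f /L2span_rangeP[Lf [b fb]]; apply/L2span_rangeP; split=> //.
  exists (b *m (V^T *m invmx LY)).
  by rewrite -lin_comb_mul_mx_fun.
- exists nuhat; split=> //.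
  by apply/(mul_mx_fun_free nu_free (fun=> ae_eq_refl _ _ _)).
move=> W WY [f [Lf f_free WE]].
have /choice[b bE] : forall l, exists b : 'rV[R]_q,
    f l = \sum_i b 0 i *: nu i %[ae muO].
  move=> l; have : W (f l) by rewrite WE; exact: L2span_range_mem.
  by move=> /WY /L2span_rangeP[].
pose B := \matrix_l b l.
have fB l : f l = mul_mx_fun B nu l %[ae muO].
  suff -> : mul_mx_fun B nu l = \sum_i b l 0 i *: nu i by exact: bE.
  by apply: eq_bigr => i _; rewrite mxE.
have Bf : row_free B by apply/(mul_mx_fun_free nu_free fB).
rewrite /error WE.
have := st_error_coord Lnu Lpsi LY_factor LS_factor Lf fB Bf LYunit LSunit Lx X_coef.
rewrite /= -/muO -/muT => ->.
have := st_error_coord Lnu Lpsi LY_factor LS_factor Lnuhat (fun=> ae_eq_refl _ _ _)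
  Bfree LYunit LSunit Lx X_coef.
rewrite /= -/muO -/muT -/Yhat => ->.
rewrite -/A ler_wsqrtr// lerD2l lerN2.
have QV : LY^T *m (V^T *m invmx LY)^T = V.
  by rewrite trmx_mul trmxK trmx_inv mulKVmx// unitmx_tr.
have PV : orthoproj_mx V = V *m V^T.
  by rewrite /orthoproj_mx VV invmx1 mulmx1.
rewrite QV PV {1 2}VE (leading_sv_trace svdA) (svd_gram svdA).
have Qfree : row_free (LY^T *m B^T)^T.
  by rewrite trmx_mul !trmxK /row_free mxrankMfree// row_free_unit.
apply: fan_trace => //.
- exact: orthoproj_mx_tr.
- exact: orthoproj_mx_id.
- exact: orthoproj_mx_trace.
- by case: svdA.
by move=> i j; exact: (sqsv_noninc svdA).
Qed.
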